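(* Let $\alpha\in(0,1)$, let $H_1,\dots,H_K$ be hypotheses (sets of probability measures on a measurable space with a filtration $(\mathcal F_t)_{t\ge0}$, discrete time), let $P^*$ be the true data-generating probability measure, let $\mathcal N=\{k:P^*\in H_k\}$ and $K_0=|\mathcal N|$. For each $k$ let $(E^k_t)_{t\ge 0}$ be an $e$-process for $H_k$ with respect to $(\mathcal F_t)$, with arbitrary dependence between the $K$ processes. Let $\mathrm A:[1,\infty]\to[0,\infty]$ be an admissible adjuster, and let $M^k_s=\max_{0\le t\le s}E^k_t$ and $M^k_\infty=\sup_{t\ge 0}E^k_t$. Then the e-BH procedure at level $\alpha$ applied to the adjusted running maxima controls the FDR-sup at level $K_0\alpha/K$, that is, $$\sup_{s\in\mathbb N}\mathrm{FDR}\big(\mathrm A(M^1_s),\dots,\mathrm A(M^K_s)\big)\le \frac{K_0\alpha}{K}\quad\text{and}\quad \mathrm{FDR}\big(\mathrm A(M^1_\infty),\dots,\mathrm A(M^K_\infty)\big)\le\frac{K_0\alpha}{K}.$$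
   Context: An $e$-process for a hypothesis $H$ with respect to $(\mathcal F_t)_{t\ge0}$ is a nonnegative process $(E_t)_{t\ge 0}$ adapted to $(\mathcal F_t)$, with $E_0=1$, such that $\mathbb E_P[E_\tau]\le 1$ for every (finite) stopping time $\tau$ and every $P\in H$. All $e$-processes are adapted to one common filtration. An admissible adjuster is an increasing function $\mathrm A:[1,\infty]\to[0,\infty]$ that is right-continuous, satisfies $\mathrm A(\infty)=\lim_{x\to\infty}\mathrm A(x)=\infty$, and $\int_1^\infty \mathrm A(x)/x^2\,dx=1$. e-BH procedure at level $\alpha$ applied to $(x_1,\dots,x_K)\in[0,\infty]^K$: let $x_{[1]}\ge\dots\ge x_{[K]}$ be the values sorted from largest to smallest, let $k^*=\max\{k\in\{1,\dots,K\}: x_{[k]}\ge K/(\alpha k)\}$, and reject the $k^*$ hypotheses with the largest values (reject none if the set is empty). For random $(X_1,\dots,X_K)$ with e-BH rejection set $\mathcal R$, $\mathrm{FDR}(X_1,\dots,X_K)=\mathbb E_{P^*}[|\mathcal R\cap\mathcal N|/(|\mathcal R|\vee 1)]$. The FDR-sup of a procedure based on the running maxima is the supremum over times $s$ of its FDR when applied to the running maxima up to $s$, which the paper identifies with the FDR of the procedure applied to the suprema over all times. *)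

(* Defs.v *)
From HB Require Import structures.
From mathcomp Require Import all_boot all_order all_algebra.
From mathcomp Require Import all_classical all_reals all_analysis measurable_realfun.

Set Implicit Arguments.
Unset Strict Implicit.
Unset Printing Implicit Defensive.

Import Order.TTheory GRing.Theory Num.Theory.
Import numFieldNormedType.Exports.

Local Open Scope classical_set_scope.
Local Open Scope ring_scope.
Local Open Scope ereal_scope.

Section Processes.
Context {d : measure_display} {T : measurableType d} {R : realType}.

Definition filtration (F : nat -> set (set T)) : Prop :=
  [/\ forall t, sigma_algebra setT (F t),
      forall t, F t `<=` measurable
    & forall s t, (s <= t)%N -> F s `<=` F t].

Definition adapted (F : nat -> set (set T)) (E : nat -> T -> \bar R) : Prop :=
  forall (t : nat) (B : set (\bar R)), measurable B -> F t (E t @^-1` B).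

(* Finiteness of the stopping time is built into the codomain [nat]. *)
Definition stopping_time (F : nat -> set (set T)) (tau : T -> nat) : Prop :=
  forall t, F t [set w | (tau w <= t)%N].

(* Processes may take the value +oo; real-valued ones embed via [EFin]. *)
Definition e_process (F : nat -> set (set T)) (H : set (probability T R))
    (E : nat -> T -> \bar R) : Prop :=
  [/\ forall t w, 0 <= E t w,
      adapted F E,
      forall w, E 0%N w = 1
    & forall (tau : T -> nat) (P : probability T R),
        stopping_time F tau -> H P -> \int[P]_w E (tau w) w <= 1].

Definition running_max (E : nat -> T -> \bar R) (s : nat) (w : T) : \bar R :=
  \big[maxe/-oo]_(t < s.+1) E t w.

Definition overall_sup (E : nat -> T -> \bar R) (w : T) : \bar R :=
  ereal_sup (range (fun t => E t w)).

End Processes.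

(* An adjuster is a function on [1, +oo]; its values below 1 are irrelevant.
   "Increasing" is meant in the weak sense. *)
Definition admissible_adjuster {R : realType} (A : \bar R -> \bar R) : Prop :=
  [/\ forall x, 1 <= x -> 0 <= A x,
      forall x y, 1 <= x -> x <= y -> A x <= A y,
      forall x : R, (1 <= x)%R -> A y%:E @[y --> x^'+] --> A x%:E,
      A +oo = +oo /\ (A y%:E @[y --> +oo%R] --> +oo)
    & \int[lebesgue_measure]_(x in `[1%R, +oo[) (A x%:E * (x ^- 2)%:E) = 1].

Section eBH.
Context {R : realType} {K : nat}.

(* Ties are broken by index.  This does not affect the rejection set: values
   tied with x_[k*] pass the threshold too, so by maximality of k* they all
   occur among the first k*. *)
Definition decreasing_indices (x : 'I_K -> \bar R) : seq 'I_K :=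
  sort (fun i j => x j <= x i) (enum 'I_K).

(* x_[k], for k between 1 and K *)
Definition order_stat (x : 'I_K -> \bar R) (k : nat) : \bar R :=
  nth 0 [seq x i | i <- decreasing_indices x] k.-1.

(* k*, equal to 0 when no k qualifies *)
Definition eBH_num (alpha : R) (x : 'I_K -> \bar R) : nat :=
  \max_(k < K.+1 |
      (0 < k)%N && ((K%:R / (alpha * k%:R))%:E <= order_stat x k)) k.

Definition eBH (alpha : R) (x : 'I_K -> \bar R) : {set 'I_K} :=
  [set i in take (eBH_num alpha x) (decreasing_indices x)]%SET.

Context {d : measure_display} {T : measurableType d}.

Definition true_nulls (H : 'I_K -> set (probability T R))
    (Pstar : probability T R) : {set 'I_K} :=
  [set k | `[< H k Pstar >]]%SET.

Definition eBH_FDR (Pstar : probability T R) (N : {set 'I_K}) (alpha : R)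
    (X : 'I_K -> T -> \bar R) : \bar R :=
  'E_Pstar[fun w : T => let Rej := eBH alpha (fun k => X k w) in
    (#|(Rej :&: N)%SET|%:R / (maxn #|Rej| 1)%:R)%R].

End eBH.

(* Main.v *)
Require Import Defs.
From HB Require Import structures.
From mathcomp Require Import all_boot all_order all_algebra.
From mathcomp Require Import all_classical all_reals all_analysis measurable_realfun.

(** Write [M k] for the supremum over all times of the [k]-th e-process.

    Under a true null, stopping the e-process when it first reaches a level [c]
    gives Ville's inequality [P (M k >= c) <= 1 / c] ([e_process_sup_tail]).  So
    [M k], which is at least 1, is stochastically smaller than the variable with
    density [x ^- 2] on [[1, +oo[].  The adjuster [A] is nondecreasing and has
    mean exactly 1 under that density, hence [A (M k)] has mean at most 1 under
    the null: it is an e-value ([integral_adjuster_le1]).  The comparison of the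
    two means is made level by level, through the layer-cake formula
    ([layer_cake_weighted]).

    The e-BH procedure controls the false discovery rate for arbitrarily
    dependent e-values.  A rejected value is at least [K / (alpha * #|Rej|)]
    ([eBH_selected_ge]), so the false discovery proportion is bounded pointwise
    by [alpha / K] times the sum of the null e-values ([eBH_FDP_le]), and it
    remains to take expectations.

    For a finite horizon [s], the adjusted running maximum is pointwise at most
    [A (M k)], so the bound for e-BH applied to values dominated by e-values
    ([eBH_FDR_le]) gives both conclusions at once. *)

Import Order.TTheory GRing.Theory Num.Theory.
Import numFieldNormedType.Exports.

Local Open Scope classical_set_scope.
Local Open Scope ring_scope.
Local Open Scope ereal_scope.

(** * Comparison of integrals and the layer-cake formula *)

(** The integral of a nonnegative function is a supremum over the simple
    functions below it, and enlarging the function only enlarges that family.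
    This is how the false discovery proportion of a procedure run on arbitrary
    inputs is compared with a sum of e-values. *)
Lemma ge0_le_integral_nonmeasurable (d : measure_display) (T : measurableType d)
    (R : realType) (mu : {measure set T -> \bar R}) (D : set T)
    (f g : T -> \bar R) :
  (forall x, D x -> 0 <= f x) -> (forall x, D x -> f x <= g x) ->
  \int[mu]_(x in D) f x <= \int[mu]_(x in D) g x.
Proof.
move=> f0 fg; have g0 x : D x -> 0 <= g x.
  by move=> Dx; exact: le_trans (f0 x Dx) (fg x Dx).
rewrite !ge0_integralE//; apply: ereal_sup_le => _ [h /= hf <-].
by exists h => // x; apply: le_trans (hf x) _; exact: lee_restrict.
Qed.

(** Tonelli, applied to [h x] on the region [0 <= y < f x].  The weight [h] lets
    the same formula serve for a random variable under [P] (with [h] equal to 1)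
    and for the adjuster under the density [x ^- 2]. *)
Lemma layer_cake_weighted (d : measure_display) (T : measurableType d)
    (R : realType) (mu : {sigma_finite_measure set T -> \bar R})
    (h f : T -> \bar R) :
  measurable_fun setT h -> measurable_fun setT f ->
  (forall x, 0 <= h x) -> (forall x, 0 <= f x) ->
  \int[mu]_x (h x * f x) =
  \int[lebesgue_measure]_(y in `[0%R, +oo[) \int[mu]_(x in [set x | y%:E < f x]) h x.
Proof.
move=> mh mf h0 f0.
pose GR := measurableTypeR R.
pose S : set (T * GR) := [set p | (0 <= p.2)%R] `&` [set p | p.2%:E < f p.1].
have mS : measurable S.
  have m2 : measurable_fun setT (fun p : T * GR => p.2%:E).
    by apply/measurable_EFinP; exact: measurable_snd.
  apply: measurableI; rewrite -[X in measurable X]setTI.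
    have -> : [set p : T * GR | (0 <= p.2)%R] = [set p | 0 <= p.2%:E].
      by apply/seteqP; split => p /=; rewrite lee_fin.
    exact: measurable_lee.
  by apply: measurable_lte => //; exact: measurableT_comp.
pose g (p : T * GR) := h p.1 * (\1_S p)%:E.
have mg : measurable_fun setT g.
  apply: emeasurable_funM; first exact: measurableT_comp.
  by apply/measurable_EFinP; exact: measurable_indic.
have g0 p : 0 <= g p by rewrite mule_ge0// lee_fin.
have E1 x : \int[lebesgue_measure]_y g (x, y) = h x * f x.
  rewrite /g/= ge0_integralZl//; last first.
  - by apply/measurable_EFinP; apply: measurableT_comp => //; exact: measurable_indic.
  congr (_ * _).
  have mSx : measurable (xsection S x) by exact: measurable_xsection.
  rewrite (eq_integral (fun y : GR => (\1_(xsection S x) y)%:E)); last first.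
    by move=> y _; rewrite !indicE mem_xsection.
  rewrite integral_indic// setIT.
  have fx0 := f0 x.
  case fxE: (f x) fx0 => [r| |]// r0.
  - have -> : xsection S x = `[0%R, r[%classic.
      apply/seteqP; split => y; rewrite /xsection /S/= in_itv/= inE/= fxE lte_fin.
        by case=> -> ->.
      by move=> /andP[].
    apply: (etrans (lebesgue_measure_itv _)); rewrite /= lte_fin.
    move: r0; rewrite lee_fin le_eqVlt => /predU1P[<-|->].
      by rewrite ltxx.
    by rewrite oppr0 adde0.
  - have -> : xsection S x = `[0%R, +oo[%classic.
      apply/seteqP; split => y; rewrite /xsection /S/= in_itv/= inE/= fxE ltry andbT.
        by case.
      by [].
    by apply: (etrans (lebesgue_measure_itv _)); rewrite /= ltry.
rewrite -(eq_integral _ _ (fun x _ => E1 x)).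
rewrite (fubini_tonelli g)//.
rewrite [RHS]integral_mkcond; apply: eq_integral => y _.
rewrite patchE; case: ifPn => y0; last first.
  apply: integral0_eq => x _; rewrite /g indicE memNset ?mule0//= => -[/= y0' _].
  by move: y0; rewrite notin_setE/= in_itv/= y0'.
rewrite [RHS]integral_mkcond; apply: eq_integral => x _.
rewrite /g patchE indicE/=; move: y0; rewrite inE/= in_itv/= andbT => y0.
have [xy|xy] := boolP (y%:E < f x); first by rewrite !mem_set ?mule1.
by move/negP: xy => xy; rewrite !memNset ?mule0//= => -[].
Qed.

(** * Adjusters and the density [x ^- 2] *)

(** The superlevel sets of a nondecreasing function are half-lines, open or
    closed according to whether their infimum belongs to them. *)
Lemma measurable_homo_comp (d : measure_display) (T : measurableType d)
    (R : realType) (D : set T) (A : \bar R -> \bar R) (f : T -> \bar R) :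
  measurable D -> measurable_fun D f ->
  (forall x, D x -> 1 <= f x) ->
  (forall x y, 1 <= x -> x <= y -> A x <= A y) ->
  measurable_fun D (A \o f).
Proof.
move=> mD mf f1 Ahomo _.
apply: (measurability _ (ErealGenOInfty.measurableE R)) => // _ [_ [r ->] <-].
pose U := [set x : \bar R | 1 <= x /\ r%:E < A x].
pose c := ereal_inf U.
have cU x : c < x -> 1 <= x -> r%:E < A x.
  by move=> /ereal_inf_lt[z [z1 rz] zx] _; exact: lt_le_trans rz (Ahomo _ _ z1 (ltW zx)).
have Uc x : 1 <= x -> r%:E < A x -> c <= x.
  by move=> x1 rx; exact: ereal_inf_lbound.
have [Uc'|Uc'] := pselect (U c).
  have -> : D `&` (A \o f) @^-1` `]r%:E, +oo[ = D `&` [set x | c <= f x].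
    rewrite preimage_itvoy; apply/seteqP; split => x [Dx/=] h; split => //.
      exact: Uc (f1 _ Dx) h.
    by apply: lt_le_trans Uc'.2 _; apply: Ahomo Uc'.1 h.
  exact: emeasurable_fun_c_infty.
have -> : D `&` (A \o f) @^-1` `]r%:E, +oo[ = D `&` [set x | c < f x].
  rewrite preimage_itvoy; apply/seteqP; split => x [Dx/=] h; split => //; last first.
    exact: cU h (f1 _ Dx).
  rewrite lt_neqAle Uc ?f1// andbT; apply/eqP => cf; apply: Uc'.
  by rewrite cf; split => //; exact: f1.
exact: emeasurable_fun_o_infty.
Qed.

Lemma continuous_exprN2_itvcy (R : realType) (c : R) : (0 < c)%R ->
  {within `[c, +oo[, continuous (fun y : R => y ^- 2)}.
Proof.
move=> c0; apply: continuous_in_subspaceT => x.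
rewrite inE/= in_itv/= andbT => cx.
suff cV : {for x, continuous (fun y : R => y ^- 2)} by exact: cV.
apply: continuousV; last exact: exprn_continuous.
by rewrite expf_neq0// gt_eqF// (lt_le_trans c0).
Qed.

Lemma measurable_exprN2_itvcy (R : realType) (c : R) : (0 < c)%R ->
  measurable_fun `[c, +oo[ (fun y : R => (y ^- 2)%:E).
Proof.
move=> c0; apply/measurable_EFinP.
apply: subspace_continuous_measurable_fun => //.
exact: continuous_exprN2_itvcy.
Qed.

Lemma integral_exprN2_tail (R : realType) (c : R) : (0 < c)%R ->
  \int[lebesgue_measure]_(x in `]c, +oo[) (x ^- 2)%:E = (c^-1)%:E.
Proof.
move=> c0.
have dV (x : R) : (c <= x)%R -> derivable (fun y : R => y^-1)%R x 1%R.
  by move=> cx; apply: derivableV => //; rewrite gt_eqF// (lt_le_trans c0).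
rewrite integral_itv_obnd_cbnd; last first.
  apply: measurable_funS (measurable_exprN2_itvcy _ _ c0) => //.
  by move=> x/=; rewrite !in_itv/= !andbT; exact: ltW.
rewrite (@ge0_continuous_FTC2y _ _ (fun y => - y^-1)%R _ 0%R)//.
- by rewrite EFinN oppeK add0e.
- by move=> x cx; rewrite invr_ge0 sqr_ge0.
- exact: continuous_exprN2_itvcy.
- rewrite -oppr0; apply: cvgN.
  apply/gtr0_cvgV0; last exact: cvg_id.
  exact: nbhs_pinfty_gt.
- by move=> x cx; apply: derivableN; exact/dV/ltW.
- apply: cvg_at_right_filter; apply: continuousN.
  by apply: inv_continuous; rewrite gt_eqF.
- move=> x; rewrite in_itv/= andbT => cx.
  rewrite derive1E deriveN; last exact/dV/ltW.
  rewrite deriveV//; last by rewrite gt_eqF// (lt_trans c0).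
  by rewrite derive_id scaleNr opprK /GRing.scale/= mulr1.
Qed.

(** The tail hypothesis says that [M] is stochastically dominated by the
    variable with density [x ^- 2] on [[1, +oo[], under which [A] has mean 1.
    Dominance passes to [A] because, at each level [y], the conditions
    [A (M w) > y] and [A x > y] put [M w] and [x] in half-lines starting at the
    same point [c]. *)
Lemma integral_adjuster_le1 (d : measure_display) (T : measurableType d)
    (R : realType) (P : probability T R) (A : \bar R -> \bar R)
    (M : T -> \bar R) :
  admissible_adjuster A -> measurable_fun setT M -> (forall w, 1 <= M w) ->
  (forall c : R, (1 <= c)%R -> P [set w | c%:E <= M w] <= (c^-1)%:E) ->
  \int[P]_w A (M w) <= 1.
Proof.
move=> [A0 Ahomo _ [_ Ay] A1] mM M1 tailM.
pose D : set R := `[1%R, +oo[%classic.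
have DE x : D x = (1 <= x)%R by rewrite /D/= in_itv/= andbT.
pose h : R -> \bar R := (fun x => (x ^- 2)%:E) \_ D.
(* [A] is only controlled on [1, +oo]; truncating its argument at 1 makes it
   nonnegative and measurable on all of [R] and is harmless where [h] lives. *)
pose f (x : R) : \bar R := A (maxe 1 x%:E).
have mAM : measurable_fun setT (A \o M) by exact: measurable_homo_comp.
have mf : measurable_fun setT f.
  apply: (@measurable_homo_comp _ _ _ _ A (fun x : R => maxe 1 x%:E)) => //.
    by apply: measurable_maxe => //; exact/measurable_EFinP.
  by move=> x _; rewrite le_max lexx.
have mh : measurable_fun setT h.
  apply/(measurable_restrictT _ _).1 => //; first exact: measurable_itv.
  exact: measurable_exprN2_itvcy.
have h0 x : 0 <= h x.
  by apply: erestrict_ge0 => z _; rewrite lee_fin invr_ge0 sqr_ge0.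
have f0 x : 0 <= f x by apply: A0; rewrite le_max lexx.
rewrite -A1 [leRHS](_ : _ = \int[lebesgue_measure]_x (h x * f x)); last first.
  rewrite integral_mkcond; apply: eq_integral => x _.
  rewrite /h !patchE; case: ifPn => [|_]; last by rewrite mul0e.
  by rewrite -/D => /set_mem; rewrite DE => x1; rewrite muleC /f max_r.
rewrite layer_cake_weighted//.
rewrite [leLHS](_ : _ = \int[P]_w (cst 1 w * (A \o M) w)); last first.
  by apply: eq_integral => w _; rewrite /= mul1e.
rewrite (layer_cake_weighted _ _ _ _ (cst 1) (A \o M))//; last by move=> w; exact: A0.
apply: ge0_le_integral_nonmeasurable => y; rewrite /= in_itv/= andbT => y0.
  exact: integral_ge0.
have mU : measurable [set w | y%:E < A (M w)].
  by rewrite -[X in measurable X]setTI; exact: emeasurable_fun_o_infty.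
rewrite integral_cst// mul1e.
pose S := [set x : R | (1 <= x)%R /\ y%:E < A x%:E].
have S0 : S !=set0.
  have /cvgeyPgt/(_ y) [N [_ HN]] := Ay.
  exists (Num.max 1 (N + 1))%R; split; first by rewrite le_max lexx.
  by apply: HN; rewrite lt_max ltrDl ltr01 orbT.
have S1 : lbound S 1%R by move=> x [].
have hS : has_inf S by split=> //; exists 1%R.
(* [S] need not contain its infimum: the level set of [A o M] is only placed
   inside the closed half-line at [c], that of [A] around the open one, and
   [x ^- 2] gives these two half-lines the same mass. *)
pose c := inf S.
have c1 : (1 <= c)%R by exact: lb_le_inf.
have c0 : (0 < c)%R by exact: lt_le_trans c1.
apply: (@le_trans _ _ (P [set w | c%:E <= M w])).
  apply: le_measure; rewrite ?inE//.
    by rewrite -[X in measurable X]setTI; exact: emeasurable_fun_c_infty.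
  move=> w /=; have := M1 w; case: (M w) => [r| |]// r1 yr; last exact: leey.
  by rewrite lee_fin; apply: ge_inf => //; exists 1%R.
apply: le_trans (tailM _ c1) _.
rewrite -integral_exprN2_tail//.
rewrite [leLHS](_ : _ = \int[lebesgue_measure]_(x in `]c, +oo[) h x); last first.
  apply: eq_integral => x; rewrite inE/= in_itv/= andbT => cx.
  by rewrite /h patchE mem_set// DE (le_trans c1)// ltW.
apply: ge0_subset_integral => //.
- by rewrite -[X in measurable X]setTI; exact: emeasurable_fun_o_infty.
- exact: measurable_funTS.
- move=> x /=; rewrite in_itv/= andbT => /(inf_lt hS.1)/= [z [z1 yz] zx].
  apply: (lt_le_trans yz); apply: Ahomo; first by rewrite lee_fin.
  by rewrite le_max !lee_fin (ltW zx) orbT.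
Qed.

(** * The maximal inequality for e-processes *)

(** The first passage above [c], truncated at [s]: [find] returns the length [s]
    of the list when its search fails. *)
Definition hitting_time {T : Type} {R : realType} (E : nat -> T -> \bar R)
    (c : \bar R) (s : nat) (w : T) : nat :=
  find (fun t => c <= E t w) (iota 0 s).

Lemma hitting_time_gt (T : Type) (R : realType) (E : nat -> T -> \bar R)
    (c : \bar R) (s t : nat) (w : T) : (t < s)%N ->
  (hitting_time E c s w <= t)%N = has (fun i => c <= E i w) (iota 0 t.+1).
Proof.
move=> ts; rewrite -ltnS /hitting_time -has_take_leq ?size_iota//.
by rewrite take_iota (minn_idPl ts).
Qed.

(** If the level is reached exactly at time [s], and not before, the search
    over [0 .. s-1] fails and the default value [s] is the correct answer. *)
Lemma hitting_timeP (T : Type) (R : realType) (E : nat -> T -> \bar R)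
    (c : \bar R) (s t : nat) (w : T) : (t <= s)%N -> c <= E t w ->
  c <= E (hitting_time E c s w) w.
Proof.
move=> ts ct; rewrite /hitting_time; set p := fun i => _.
have [hasp|hasNp] := boolP (has p (iota 0 s)).
  have := nth_find 0%N hasp; rewrite nth_iota ?add0n//.
  by rewrite -[X in (_ < X)%N](size_iota 0 s) -has_find.
rewrite hasNfind// size_iota.
suff -> : s = t by [].
apply/eqP; rewrite eqn_leq ts andbT leqNgt; apply: contra hasNp => ts'.
by apply/hasP; exists t => //; rewrite mem_iota.
Qed.

Lemma hitting_time_stopping (d : measure_display) (T : measurableType d)
    (R : realType) (F : nat -> set (set T)) (E : nat -> T -> \bar R)
    (c : \bar R) (s : nat) :
  filtration F -> adapted F E -> stopping_time F (hitting_time E c s).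
Proof.
move=> [sF _ Fhomo] adE t; have [F0 FC FU] := sF t.
have [st|ts] := leqP s t.
  rewrite (_ : [set w | _] = setT `\` set0); first exact: FC.
  rewrite setD0; apply/seteqP; split => w //= _; apply: (leq_trans _ st).
  by rewrite -[X in (_ <= X)%N](size_iota 0 s); exact: find_size.
rewrite (_ : [set w | _] =
    \bigcup_i (if (i <= t)%N then [set w | c <= E i w] else set0)).
  apply: FU => i; case: ifPn => // it; apply: (Fhomo _ _ it).
  by rewrite -preimage_itvcy; apply: adE; exact: emeasurable_itv.
apply/seteqP; split => w /=; rewrite hitting_time_gt//.
  by move=> /hasP[i]; rewrite mem_iota add0n ltnS /= => it ci; exists i => //; rewrite it.
move=> [i _]; case: ifPn => // it ci; apply/hasP; exists i => //.
by rewrite mem_iota.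
Qed.

Lemma adapted_measurable (d : measure_display) (T : measurableType d)
    (R : realType) (F : nat -> set (set T)) (E : nat -> T -> \bar R) (t : nat) :
  filtration F -> adapted F E -> measurable_fun setT (E t).
Proof. by move=> [_ FT _] adE _ B mB; rewrite setTI; apply/FT/adE. Qed.

Lemma measurable_overall_sup (d : measure_display) (T : measurableType d)
    (R : realType) (E : nat -> T -> \bar R) :
  (forall t, measurable_fun setT (E t)) -> measurable_fun setT (overall_sup E).
Proof.
move=> mE; rewrite (_ : overall_sup E = fun w => esups (E ^~ w) 0%N).
  exact: measurable_fun_esups.
apply/funext => w; congr ereal_sup.
by apply/seteqP; split => _ [t _ <-]; exists t.
Qed.

(** Ville's inequality: Markov's inequality for [E] stopped at the first passage
    above [c], whose expectation is at most 1 by definition of an e-process. *)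
Lemma e_process_maximal (d : measure_display) (T : measurableType d)
    (R : realType) (F : nat -> set (set T)) (H : set (probability T R))
    (E : nat -> T -> \bar R) (P : probability T R) (c : R) (s : nat) :
  filtration F -> e_process F H E -> H P -> (0 < c)%R ->
  P (\bigcup_(t in [set t | (t <= s)%N]) [set w | c%:E <= E t w])
    <= (c^-1)%:E.
Proof.
move=> filtF [E0 adE _ eE] HP c0; set B := \bigcup_(_ in _) _.
have mB : measurable B.
  apply: bigcup_measurable => t _; rewrite -[X in measurable X]setTI.
  by apply: emeasurable_fun_c_infty => //; exact: adapted_measurable adE.
have -> : (c^-1)%:E = c^-1%:E * 1 by rewrite mule1.
rewrite -lee_pdivrMl ?invr_gt0// invrK.
apply: le_trans (eE _ _ (hitting_time_stopping _ _ _ _ _ c%:E s filtF adE) HP).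
rewrite -[X in P X]setIT -integral_indic// -ge0_integralZl_EFin//; last first.
- exact: ltW.
- by apply/measurable_EFinP; exact: measurable_indic.
apply: ge0_le_integral_nonmeasurable => w _.
  by rewrite mule_ge0// lee_fin// ltW.
rewrite indicE; case: (boolP (w \in B)) => [|_]; last by rewrite mule0.
by rewrite inE mule1 => -[t /= ts]; exact: hitting_timeP.
Qed.

(** A supremum equal to [c] may be approached without being attained, so the
    finite-horizon inequality is applied to levels [b < c], the horizon is sent
    to infinity, and then [b] to [c]. *)
Lemma e_process_sup_tail (d : measure_display) (T : measurableType d)
    (R : realType) (F : nat -> set (set T)) (H : set (probability T R))
    (E : nat -> T -> \bar R) (P : probability T R) (c : R) :
  filtration F -> e_process F H E -> H P -> (0 < c)%R ->
  P [set w | c%:E <= overall_sup E w] <= (c^-1)%:E.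
Proof.
move=> filtF eE HP c0.
have mE t : measurable_fun setT (E t).
  by case: eE => _ adE _ _; exact: adapted_measurable adE.
have msup := measurable_overall_sup _ _ _ _ mE.
set S := [set w | _].
have mS : measurable S.
  by rewrite -[S]setTI; exact: emeasurable_fun_c_infty.
have key (b : R) : (0 < b < c)%R -> P S <= (b^-1)%:E.
  move=> /andP[b0 bc].
  pose B s := \bigcup_(t in [set t | (t <= s)%N]) [set w | b%:E <= E t w].
  have mB s : measurable (B s).
    apply: bigcup_measurable => t _; rewrite -[X in measurable X]setTI.
    exact: emeasurable_fun_c_infty.
  have mUB : measurable (\bigcup_s B s) by exact: bigcupT_measurable.
  apply: (@le_trans _ _ (P (\bigcup_s B s))).
    apply: le_measure; rewrite ?inE// => w /= cw.
    have /ereal_sup_gt[_ [t _ <-] bt] : b%:E < overall_sup E w.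
      by apply: lt_le_trans cw; rewrite lte_fin.
    by exists t => //; exists t => //=; exact: ltW.
  have cvgB : (P \o B) n @[n --> \oo] --> P (\bigcup_s B s).
    apply: nondecreasing_cvg_mu => // m n mn; apply/subsetPset => w [t tm bt].
    by exists t => //=; exact: leq_trans tm mn.
  rewrite -(cvg_lim _ cvgB)//; apply: lime_le; first exact: cvgP cvgB.
  by apply: nearW => s; exact: e_process_maximal eE HP b0.
have finPS : P S \is a fin_num by exact: fin_num_measure.
rewrite -(fineK finPS) lee_fin; set p := fine _.
have {}key (b : R) : (0 < b < c)%R -> (p <= b^-1)%R.
  by move=> /key; rewrite -(fineK finPS) lee_fin.
rewrite leNgt; apply/negP => cp.
have p0 : (0 < p)%R by rewrite (lt_trans _ cp)// invr_gt0.
(* If [p > 1/c], the level halfway between [1/p] and [c] contradicts [key]. *)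
have pc : (p^-1 < c)%R by rewrite invf_plt.
have /key : (0 < (p^-1 + c) / 2 < c)%R.
  by rewrite midf_lt// andbT divr_gt0// addr_gt0// invr_gt0.
rewrite leNgt => /negP; apply.
rewrite invf_plt ?posrE ?midf_lt//.
by rewrite divr_gt0// addr_gt0// invr_gt0.
Qed.

(** * The e-BH procedure *)

Lemma card_eBH (R : realType) (K : nat) (alpha : R) (x : 'I_K -> \bar R) :
  #|eBH alpha x| = eBH_num alpha x.
Proof.
rewrite /eBH cardsE (card_uniqP _); last first.
  by rewrite take_uniq// sort_uniq enum_uniq.
rewrite size_takel// size_sort size_enum_ord.
by apply/bigmax_leqP => k _; rewrite -ltnS.
Qed.

(** Self-consistency of e-BH: a selected value is at least [x_[k*]], since it
    comes before it in the sorted list, and [k*] is the number of rejections. *)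
Lemma eBH_selected_ge (R : realType) (K : nat) (alpha : R) (x : 'I_K -> \bar R)
    (k : 'I_K) : k \in eBH alpha x ->
  (K%:R / (alpha * #|eBH alpha x|%:R))%:E <= x k.
Proof.
rewrite card_eBH inE; set m := eBH_num alpha x; set s := decreasing_indices x.
move=> kin.
have sizes : size s = K by rewrite size_sort size_enum_ord.
have km : (index k s < m)%N by exact: index_ltn.
have ks : k \in s by exact: mem_take kin.
have m0 : (0 < m)%N by exact: leq_ltn_trans km.
have mK : (m <= K)%N by apply/bigmax_leqP => j _; rewrite -ltnS.
have : (K%:R / (alpha * m%:R))%:E <= order_stat x m.
  have [|j Pj mj] := @eq_bigmax_cond _ (fun j : 'I_K.+1 =>
      (0 < j)%N && ((K%:R / (alpha * j%:R))%:E <= order_stat x j))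
    (fun j => val j).
    rewrite lt0n; apply: contraTneq m0 => /card0_eq Pn.
    by rewrite /m /eBH_num big_pred0.
  rewrite /m /eBH_num mj; by have /andP[] := Pj.
move=> /le_trans; apply.
rewrite /order_stat -/s (nth_map k); last by rewrite sizes prednK.
rewrite -[in leRHS](nth_index k ks).
have tr : transitive (fun i j : 'I_K => x j <= x i).
  by move=> a b c ab ca; exact: le_trans ca ab.
have sorteds : sorted (fun i j => x j <= x i) s.
  by apply: sort_sorted => i j; exact: le_total.
apply: (sorted_leq_nth tr _ k sorteds) => //.
- by rewrite inE index_mem.
- by rewrite inE sizes prednK.
- by rewrite -ltnS prednK.
Qed.

(** By self-consistency each rejected null [k] contributes
    [1 / #|Rej| <= alpha / K * x k]; the other nulls contribute nothing on the
    left and something nonnegative on the right.  The bound is linear in [x],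
    so its expectation is blind to the dependence between the inputs. *)
Lemma eBH_FDP_le (R : realType) (K : nat) (alpha : R) (N : {set 'I_K})
    (x : 'I_K -> \bar R) :
  (0 < alpha)%R -> (forall k, k \in N -> 0 <= x k) ->
  (#|(eBH alpha x :&: N)%SET|%:R / (maxn #|eBH alpha x| 1)%:R)%:E
    <= \sum_(k in N) (alpha / K%:R)%:E * x k.
Proof.
move=> a0 x0; set Rej := eBH alpha x.
have t0 k : k \in N -> 0 <= (alpha / K%:R)%:E * x k.
  by move=> kN; rewrite mule_ge0 ?x0// lee_fin divr_ge0// ltW.
have [R0|R0] := posnP #|Rej|.
  rewrite (cards0_eq R0) finset.set0I cards0 mul0r; exact: sume_ge0.
have K0 : (0 < K)%N by apply: leq_trans R0 _; rewrite -[leqRHS](card_ord K) max_card.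
rewrite (maxn_idPl R0).
apply: (@le_trans _ _ (\sum_(k in (Rej :&: N)%SET) (alpha / K%:R)%:E * x k)).
  rewrite [leLHS](_ : _ = \sum_(k in (Rej :&: N)%SET) (#|Rej|%:R^-1)%:E); last first.
    by rewrite sumEFin sumr_const mulr_natl.
  apply: lee_sum => k; rewrite inE => /andP[kR kN].
  have aK0 : 0 <= (alpha / K%:R)%:E by rewrite lee_fin divr_ge0// ltW.
  apply: le_trans (lee_wpmul2l aK0 (eBH_selected_ge _ _ _ _ _ kR)).
  rewrite -EFinM lee_fin invfM !mulrA divfK ?pnatr_eq0 -?lt0n//.
  by rewrite mulfV ?gt_eqF// mul1r.
rewrite [leRHS](big_setID Rej)/= finset.setIC leeDl// sume_ge0// => k.
by rewrite inE => /andP[_]; exact: t0.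
Qed.

(** The procedure reads [X], and the e-values [Y] only serve in the bound on its
    false discovery proportion: a single family [Y], built from the suprema over
    all times, then serves every time horizon. *)
Lemma eBH_FDR_le (R : realType) (K : nat) (d : measure_display)
    (T : measurableType d) (P : probability T R) (N : {set 'I_K}) (alpha : R)
    (X Y : 'I_K -> T -> \bar R) :
  (0 < alpha)%R ->
  (forall k w, k \in N -> 0 <= X k w) ->
  (forall k w, k \in N -> X k w <= Y k w) ->
  (forall k, k \in N -> measurable_fun setT (Y k)) ->
  (forall k, k \in N -> \int[P]_w Y k w <= 1) ->
  eBH_FDR P N alpha X <= (#|N|%:R * alpha / K%:R)%:E.
Proof.
move=> a0 X0 XY mY Y1; rewrite /eBH_FDR unlock.
have aK : (0 <= alpha / K%:R)%R by rewrite divr_ge0// ltW.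
have Y0 k w : k \in N -> 0 <= Y k w by move=> kN; exact: le_trans (X0 k w kN) (XY k w kN).
apply: (@le_trans _ _ (\int[P]_w \sum_(k in N) ((alpha / K%:R)%:E * Y k w))).
  apply: ge0_le_integral_nonmeasurable => w _; first by rewrite /= lee_fin divr_ge0 ?ler0n.
  have Xw0 k : k \in N -> 0 <= X k w by exact: X0.
  apply: le_trans (eBH_FDP_le _ _ _ _ _ a0 Xw0) _.
  by apply: lee_sum => k kN; rewrite lee_wpmul2l ?lee_fin// XY.
under eq_integral do rewrite big_mkcond.
rewrite ge0_integral_sum//=; last 2 first.
- by move=> k; case: (boolP (k \in N)) => // kN; apply: measurable_funeM; exact: mY.
- move=> k w _; case: ifPn => // kN; rewrite mule_ge0 ?lee_fin//.
  exact: Y0.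
apply: (@le_trans _ _ (\sum_(k in N) (alpha / K%:R)%:E)); last first.
  by rewrite sumEFin sumr_const -mulrA mulr_natl.
rewrite [leRHS]big_mkcond/=; apply: lee_sum => k _.
case: (boolP (k \in N)) => kN; last by rewrite integral0.
rewrite ge0_integralZl_EFin//; last 2 first.
- by move=> w _; exact: Y0.
- exact: mY.
by rewrite -[leRHS]mule1 lee_wpmul2l ?lee_fin// Y1.
Qed.

(** * FDR control for adjusted running maxima *)

Lemma e_process_running_max_ge1 (d : measure_display) (T : measurableType d)
    (R : realType) (F : nat -> set (set T)) (H : set (probability T R))
    (E : nat -> T -> \bar R) (s : nat) (w : T) :
  e_process F H E -> 1 <= running_max E s w.
Proof.
move=> [_ _ E1 _]; rewrite /running_max big_ord_recl.
by rewrite le_max /= E1 lexx.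
Qed.

Lemma running_max_le_overall_sup (d : measure_display) (T : measurableType d)
    (R : realType) (E : nat -> T -> \bar R) (s : nat) (w : T) :
  running_max E s w <= overall_sup E w.
Proof.
rewrite /running_max; elim/big_ind: _ => [|x y xM yM|t _].
- exact: leNye.
- by rewrite ge_max xM yM.
- by apply: ereal_sup_ubound; exists (val t).
Qed.

Theorem theorem1 (R : realType) (d : measure_display) (T : measurableType d)
  (alpha : R) (alpha_gt0 : (0 < alpha)%R) (alpha_lt1 : (alpha < 1)%R)
  (K : nat) (K_gt0 : (0 < K)%N)
  (F : nat -> set (set T)) (filtF : filtration F)
  (H : 'I_K -> set (probability T R)) (Pstar : probability T R)
  (E : 'I_K -> nat -> T -> \bar R)
  (eE : forall k : 'I_K, e_process F (H k) (E k))
  (A : \bar R -> \bar R) (admA : admissible_adjuster A) :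
  let N := true_nulls H Pstar in
  let bound := ((#|N|%:R * alpha / K%:R)%R)%:E in
  ereal_sup (range (fun s : nat =>
    eBH_FDR Pstar N alpha (fun k w => A (running_max (E k) s w)))) <= bound
  /\
  eBH_FDR Pstar N alpha (fun k w => A (overall_sup (E k) w)) <= bound.
Proof.
move=> N bound.
pose Y k w := A (overall_sup (E k) w).
have [A0 Ahomo _ _ _] := admA.
have sup1 k w : 1 <= overall_sup (E k) w.
  apply: le_trans (running_max_le_overall_sup _ _ _ (E k) 0%N w).
  exact: e_process_running_max_ge1 (eE k).
have msup k : measurable_fun setT (overall_sup (E k)).
  apply: measurable_overall_sup => t; have [_ adE _ _] := eE k.
  exact: adapted_measurable filtF adE.
have mY k : measurable_fun setT (Y k) by exact: measurable_homo_comp.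
have Y1 k : k \in N -> \int[Pstar]_w Y k w <= 1.
  rewrite inE => /asboolP HkP; apply: integral_adjuster_le1 => // c c1.
  by apply: (e_process_sup_tail _ _ _ _ _ _ _ _ filtF (eE k) HkP); exact: lt_le_trans c1.
split; last first.
  by apply: (eBH_FDR_le _ _ _ _ _ _ _ _ Y) => // k w _; exact: A0.
apply: ge_ereal_sup => _ [s _ <-].
have max1 k w := e_process_running_max_ge1 _ _ _ _ _ _ s w (eE k).
apply: (eBH_FDR_le _ _ _ _ _ _ _ _ Y) => // k w _; first exact: A0.
by apply: Ahomo => //; exact: running_max_le_overall_sup.
Qed.
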